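(* Let $\lambda$ be a partition and let $x_1,\ldots,x_{\ell(\lambda)},y_1,\ldots,y_{\lambda_1}$ be commuting variables. Then \[ \prod_{(i,j) \in [\lambda]} \left(x_{i} + \cdots + x_{\lambda_j'} + y_{j}+ \cdots + y_{\lambda_i}\right) = \sum_{(r,s) \in \mathcal{C}'[\lambda]} \Bigg[\prod_{\substack{(i,j) \in [\lambda]\\ i \neq r,\ j \neq s }} \left(x_{i} + \cdots + x_{\lambda_j'} + y_{j}+ \cdots + y_{\lambda_i}\right)\Bigg] \cdot \left[ \prod_{i=1}^{r-1} \left(x_{i+1} + \cdots + x_{r-1} + y_{s}+ \cdots + y_{\lambda_i}\right)\right] \cdot \left[ \prod_{j=1}^{s-1} \left(x_{r}+ \cdots + x_{\lambda_j'} + y_{j+1} + \cdots + y_{s-1}\right)\right]. \]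
   Context: For a partition $\lambda=(\lambda_1\ge\lambda_2\ge\cdots\ge\lambda_\ell>0)$, $\ell(\lambda)=\ell$ is its number of parts, its Young diagram is $[\lambda]=\{(i,j)\in\mathbb{Z}^2: 1\le i\le \ell,\ 1\le j\le\lambda_i\}$ (row index $i$, column index $j$), and the conjugate partition is $\lambda'_j=\max\{i:\lambda_i\ge j\}$. The set $\mathcal{C}'[\lambda]$ of outer corners of $\lambda$ consists of the squares $(i,j)\notin[\lambda]$ with $i,j\ge 1$ such that ($i=1$ or $(i-1,j)\in[\lambda]$) and ($j=1$ or $(i,j-1)\in[\lambda]$). A sum of the form $x_a+\cdots+x_b$ (or $y_a+\cdots+y_b$) with $b<a$ is $0$; an empty product is $1$. *)

(* Defs.v *)
From mathcomp Require Export all_boot all_order all_algebra.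

Set Implicit Arguments.
Unset Strict Implicit.
Unset Printing Implicit Defensive.

Import GRing.Theory.
Local Open Scope nat_scope.

(* The parts are listed in order, so that the length of the partition la is
   size la; the empty partition is [::]. *)
Definition is_partition (la : seq nat) : bool :=
  sorted geq la && all (fun p => 0 < p) la.

(* Rows and columns are numbered from 1. [part la 1] is 0 for the empty
   partition; the junk value at i = 0 is never used. *)
Definition part (la : seq nat) (i : nat) : nat := nth 0 la i.-1.

Definition conj_part (la : seq nat) (j : nat) : nat :=
  \max_(1 <= i < (size la).+1 | j <= part la i) i.

Definition diagram (la : seq nat) : seq (nat * nat) :=
  [seq (i, j) | i <- iota 1 (size la), j <- iota 1 (part la i)].

Definition outer_corner (la : seq nat) (p : nat * nat) : bool :=
  [&& p \notin diagram la, 0 < p.1, 0 < p.2,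
      (p.1 == 1) || ((p.1.-1, p.2) \in diagram la)
    & (p.2 == 1) || ((p.1, p.2.-1) \in diagram la)].

(* The enumeration range loses no outer corner of a partition, see
   mem_outer_corners. *)
Definition outer_corners (la : seq nat) : seq (nat * nat) :=
  [seq p <- [seq (r, s) | r <- iota 1 (size la).+1,
                          s <- iota 1 (part la 1).+1] | outer_corner la p].

(* z_a + ... + z_b, which is 0 when b < a. *)
Definition isum (R : comNzRingType) (z : nat -> R) (a b : nat) : R :=
  (\sum_(a <= k < b.+1) z k)%R.

Lemma mem_diagram (la : seq nat) (i j : nat) :
  ((i, j) \in diagram la) = [&& 0 < i, i <= size la, 0 < j & j <= part la i].
Proof.
apply/allpairsPdep/idP => [[a [b [Ha Hb [-> ->]]]]|/and4P[i0 il j0 jl]].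
  by move: Ha Hb; rewrite !mem_iota !add1n !ltnS => /andP[-> ->] /andP[-> ->].
by exists i, j; rewrite !mem_iota !add1n !ltnS i0 il j0 jl.
Qed.

Lemma diagram_uniq (la : seq nat) : uniq (diagram la).
Proof.
by apply: allpairs_uniq_dep => [|i _|[a b] [c d] _ _ /= [-> ->]];
  rewrite ?iota_uniq.
Qed.

Lemma outer_corners_uniq (la : seq nat) : uniq (outer_corners la).
Proof.
by apply/filter_uniq/allpairs_uniq => [||[a b] [c d] _ _ /= [-> ->]];
  rewrite ?iota_uniq.
Qed.

Lemma part_le1 (la : seq nat) (i : nat) :
  is_partition la -> part la i <= part la 1.
Proof.
case/andP=> sla _; rewrite /part /=.
have [lei|lti] := leqP (size la) i.-1; first by rewrite nth_default.
have geq_trans : transitive geq by move=> b a c /= ba cb; apply: leq_trans cb ba.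
by apply: (sorted_leq_nth geq_trans leqnn 0 sla) => //; apply: leq_ltn_trans lti.
Qed.

Lemma mem_outer_corners (la : seq nat) (p : nat * nat) :
  is_partition la -> (p \in outer_corners la) = outer_corner la p.
Proof.
case: p => r s pla; rewrite mem_filter andb_idr //.
case/and5P=> _ r0 s0 Hr Hs; apply/allpairsP; exists (r, s).
move: r0 s0 Hr Hs; rewrite !mem_diagram !mem_iota !add1n !ltnS.
rewrite /fst /snd => r0 s0 Hr Hs; rewrite r0 s0; split=> //.
  by case/orP: Hr => [/eqP->|/and4P[_ Hr _ _]] //; rewrite -ltnS prednK in Hr.
case/orP: Hs => [/eqP->|/and4P[_ _ _ Hs]] //.
by rewrite -[s]prednK // ltnS; apply: leq_trans Hs (part_le1 _ pla).
Qed.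

(* Main.v *)
(* Write X, Y for the prefix sums of x, y and, numbering rows from 0, put
   a_r = X_r - Y_(la_r) and b_r = X_(r+1) - Y_(la_r). At an outer corner in
   row r, the row factors of the summand are a_r - b_i where those of the full
   product are a_r - a_i (i < r), and the column factors telescope along
   columns of equal height to the same quotients for i > r. Hence the summand
   T_r satisfies
     T_r * prod_(i != r) (a_r - a_i) = P * prod_i (a_r - b_i),
   with P the full product. Putting T_r = 0 for the rows r without an outer
   corner, where a_r = b_(r-1), keeps this true. So sum_r T_r = P is the
   leading coefficient of the Lagrange interpolation, at the nodes a_r, of
   P * prod_i (z - b_i). The differences of the nodes only need to be regular;
   this is arranged by deforming x over R[z], and z = 0 gives the theorem. *)
Require Import Defs.
From mathcomp Require Import all_boot all_order all_algebra.
From mathcomp Require Import zify ring.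

Import GRing.Theory.
Local Open Scope ring_scope.

(** * Interpolation at nodes with regular differences *)

(** Dividing by X - a_n keeps the other roots, because the regular factor a_n - a_i can be
    cancelled. This replaces the root bound over integral domains. *)
Lemma poly_eq0_of_roots (S : comNzRingType) (n : nat) (a : nat -> S)
    (p : {poly S}) :
  (forall i j, (i < j < n)%N -> GRing.lreg (a j - a i)) ->
  (forall i, (i < n)%N -> p.[a i] = 0) -> (size p <= n)%N -> p = 0.
Proof.
elim: n p => [|n IHn] p reg_a root_p size_p.
  by apply/eqP; rewrite -size_poly_eq0 -leqn0.
have /factor_theorem[q def_p] : root p (a n) by apply/eqP/root_p.
suff q0 : q = 0 by rewrite def_p q0 mul0r.
apply: IHn => [i j /andP[ltij ltjn]|i ltin|].
- by apply: reg_a; rewrite ltij ltnW.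
- have /eqP := root_p i (ltnW ltin).
  rewrite def_p hornerM hornerXsubC -opprB mulrN oppr_eq0 mulrC => /eqP qi0.
  by apply: (reg_a i n); rewrite ?ltin ?ltnSn ?qi0 ?mulr0.
- have [->|q_neq0] := eqVneq q 0; first by rewrite size_poly0.
  by move: size_p; rewrite def_p size_Mmonic ?monicXsubC // size_XsubC addn2.
Qed.

Lemma size_prod_XsubC_seq (S : comNzRingType) (I : Type) (s : seq I)
    (P : pred I) (a : I -> S) :
  size (\prod_(i <- s | P i) ('X - (a i)%:P)) = (count P s).+1.
Proof. by rewrite -big_filter size_prod_XsubC size_filter. Qed.

(** The hypothesis on [T] is Lagrange's formula with denominators cleared. The polynomials sum_r T_r
    A_r and P B agree at every node, hence are equal; since each A_r and B are monic of degree n,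
    comparing coefficients of X^n gives the claim. *)
Lemma lead_coef_interpolation (S : comNzRingType) (n : nat) (a b T : nat -> S)
    (P : S) :
  (forall i j, (i < j <= n)%N -> GRing.lreg (a j - a i)) ->
  (forall r, (r <= n)%N ->
     T r * \prod_(0 <= i < n.+1 | i != r) (a r - a i)
     = P * \prod_(0 <= i < n) (a r - b i)) ->
  \sum_(0 <= r < n.+1) T r = P.
Proof.
move=> reg_a eqT.
pose A r := \prod_(0 <= i < n.+1 | i != r) ('X - (a i)%:P).
pose B := \prod_(0 <= i < n) ('X - (b i)%:P).
have sizeA r : (r <= n)%N -> size (A r) = n.+1.
  move=> lern; rewrite size_prod_XsubC_seq; congr _.+1.
  have := count_predC (pred1 r) (index_iota 0 n.+1).
  rewrite size_iota subn0 count_uniq_mem ?iota_uniq // mem_index_iota /=.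
  by rewrite ltnS lern add1n => -[].
have sizeB : size B = n.+1.
  by rewrite size_prod_XsubC_seq count_predT size_iota subn0.
have leadA r : (r <= n)%N -> (A r)`_n = 1.
  move=> lern; have := monic_prod_XsubC (index_iota 0 n.+1) (fun i => i != r) a.
  by rewrite -/(A r) => /monicP; rewrite lead_coefE sizeA.
have leadB : B`_n = 1.
  have := monic_prod_XsubC (index_iota 0 n) predT b.
  by rewrite -/B => /monicP; rewrite lead_coefE sizeB.
(* Q has size at most n + 1 and vanishes at the n + 1 nodes a_0, ..., a_n. *)
pose Q := \sum_(0 <= r < n.+1) T r *: A r - P *: B.
have Q0 : Q = 0.
  apply: (@poly_eq0_of_roots S n.+1 a) => [i j ltijn|k ltkn|].
  - exact: reg_a.
  - rewrite hornerD hornerN hornerZ horner_sum.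
    rewrite (bigD1_seq k) ?mem_index_iota ?iota_uniq //= big1_seq => [|r].
      rewrite hornerZ !horner_prod.
      under eq_bigr do rewrite hornerXsubC.
      rewrite eqT // addr0; apply/eqP; rewrite subr_eq0; apply/eqP.
      by congr (_ * _); apply: eq_bigr => i _; rewrite hornerXsubC.
    case/andP=> neqrk _; rewrite hornerZ horner_prod.
    rewrite (big_rem k) ?mem_index_iota //= eq_sym neqrk.
    by rewrite hornerXsubC subrr mul0r mulr0.
  - rewrite (leq_trans (size_polyD _ _)) // geq_max size_polyN.
    rewrite (leq_trans (size_scale_leq _ _)) ?sizeB // andbT.
    rewrite big_seq; apply: (big_ind (fun p : {poly S} => (size p <= n.+1)%N)) => [|p q lep leq|r].
    + by rewrite size_poly0.
    + by rewrite (leq_trans (size_polyD _ _)) // geq_max lep.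
    + rewrite mem_index_iota => /andP[_ lern].
      by rewrite (leq_trans (size_scale_leq _ _)) ?sizeA.
have := congr1 (fun p : {poly S} => p`_n) Q0.
rewrite coef0 coefB coefZ leadB mulr1 coef_sum => /eqP.
rewrite subr_eq0 => /eqP <-; apply: eq_big_nat => r /andP[_ lern].
by rewrite coefZ leadA ?mulr1.
Qed.

(** * Prefix sums, column heights and corners *)

Definition psum {S : comNzRingType} (z : nat -> S) (n : nat) : S :=
  \sum_(1 <= k < n.+1) z k.

(** The case a = b is the empty sum, which the factors next to a corner produce. *)
Lemma isum_psum {S : comNzRingType} (z : nat -> S) (a b : nat) :
  (a <= b)%N -> isum z a.+1 b = psum z b - psum z a.
Proof.
move=> leab; rewrite /isum /psum (@big_cat_nat _ _ _ a.+1 1 b.+1) //=.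
by rewrite addrC addrK.
Qed.

Lemma leq_part (la : seq nat) (i j : nat) :
  is_partition la -> (i <= j)%N -> (nth 0%N la j <= nth 0%N la i)%N.
Proof.
case/andP=> sla _ leij.
have [lej|ltj] := leqP (size la) j; first by rewrite nth_default.
have geq_trans : transitive geq by move=> b a c /= ba cb; apply: leq_trans cb ba.
by apply: (sorted_leq_nth geq_trans leqnn 0%N sla) => //; apply: leq_ltn_trans ltj.
Qed.

Lemma part_gt0 (la : seq nat) (i : nat) :
  is_partition la -> (0 < nth 0%N la i)%N = (i < size la)%N.
Proof.
case/andP=> _ pla; have [lei|lti] := leqP (size la) i; first by rewrite nth_default.
by rewrite (all_nthP 0%N pla).
Qed.

Lemma conj_part_ge (la : seq nat) (r j : nat) :
  is_partition la -> (0 < j <= nth 0%N la r)%N -> (r < conj_part la j)%N.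
Proof.
move=> pla /andP[j0 lej]; apply: leq_bigmax_seq => //.
by rewrite mem_index_iota !ltnS -part_gt0 //= (leq_trans j0).
Qed.

Lemma conj_part_eq (la : seq nat) (r j : nat) :
  is_partition la -> (nth 0%N la r < j)%N ->
  (r == 0%N) || (0 < j <= nth 0%N la r.-1)%N -> conj_part la j = r.
Proof.
move=> pla ltj lej; apply/eqP; rewrite eqn_leq; apply/andP; split.
  apply/bigmax_leqP_seq => i; rewrite mem_index_iota => /andP[i0 _] ji.
  rewrite leqNgt; apply/negP => ltri.
  have := leq_part la r i.-1 pla; rewrite /part in ji; lia.
by case: r ltj lej => [|r] //= ltj; apply: conj_part_ge.
Qed.

(** A row has at most one outer corner, just past its last cell, and has it when the row above is
    strictly longer. The row [size la], of default length 0, gives the corner below the first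
    column. *)
Lemma perm_outer_corners (la : seq nat) :
  is_partition la ->
  perm_eq (outer_corners la)
    [seq (r.+1, (nth 0%N la r).+1) | r <- [seq r <- index_iota 0 (size la).+1
       | (r == 0%N) || (nth 0%N la r < nth 0%N la r.-1)%N]].
Proof.
move=> pla; apply: uniq_perm; first exact: outer_corners_uniq.
  by rewrite map_inj_uniq ?filter_uniq ?iota_uniq // => i j [].
case=> r s; rewrite mem_outer_corners //; apply/idP/mapP.
  case/and5P; rewrite !mem_diagram => nrs r0 s0 Hr Hs.
  exists r.-1; last first.
    congr (_, _); rewrite /part /= in nrs r0 s0 Hr Hs *; first lia.
    have := part_gt0 la r.-1 pla; lia.
  rewrite mem_filter mem_index_iota; rewrite /part /= in nrs r0 s0 Hr Hs *.
  have := part_gt0 la r.-1 pla; lia.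
case=> k; rewrite mem_filter mem_index_iota => /andP[Hk ltk] [-> ->].
rewrite /outer_corner /= !mem_diagram /part /=.
have := part_gt0 la k pla; have := part_gt0 la k.-1 pla; lia.
Qed.

(** * Splitting and telescoping products over the diagram *)

(** The row and the column of the corner meet only in the corner itself, which lies outside the
    diagram, so no cell is counted twice. *)
Lemma prod_diagram_corner (S : comNzRingType) (la : seq nat) (r : nat)
    (f : nat * nat -> S) :
  is_partition la -> (r <= size la)%N ->
  (r == 0%N) || (nth 0%N la r < nth 0%N la r.-1)%N ->
  \prod_(p <- diagram la) f p
  = \prod_(p <- diagram la | (p.1 != r.+1) && (p.2 != (nth 0%N la r).+1)) f p
    * \prod_(1 <= i < r.+1) f (i, (nth 0%N la r).+1)
    * \prod_(1 <= j < (nth 0%N la r).+1) f (r.+1, j).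
Proof.
move=> pla lern corner; rewrite (bigID (fun p => p.1 == r.+1)) /= mulrC.
rewrite (bigID (fun p => p.2 == (nth 0%N la r).+1)) /= [X in X * _]mulrC.
congr (_ * _ * _).
  rewrite -(big_map (fun i => (i, (nth 0%N la r).+1)) predT) -big_filter.
  apply/perm_big/uniq_perm.
  - exact/filter_uniq/diagram_uniq.
  - by rewrite map_inj_uniq ?iota_uniq // => i j [].
  case=> i j; rewrite mem_filter mem_diagram /part /=; apply/idP/mapP.
    move=> H; exists i; last by congr (_, _); lia.
    rewrite mem_index_iota; have := leq_part la r i.-1 pla; lia.
  case=> k; rewrite mem_index_iota => Hk [-> ->].
  have := leq_part la k.-1 r.-1 pla; have := part_gt0 la k.-1 pla; lia.
rewrite -(big_map (fun j => (r.+1, j)) predT) -big_filter.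
apply/perm_big/uniq_perm.
- exact/filter_uniq/diagram_uniq.
- by rewrite map_inj_uniq ?iota_uniq // => i j [].
case=> i j; rewrite mem_filter mem_diagram /part /=; apply/idP/mapP.
  move=> /and5P[/eqP-> _ _ j0 lej]; exists j => //.
  by rewrite mem_index_iota j0.
case=> k; rewrite mem_index_iota => Hk [-> ->].
have := part_gt0 la r pla; rewrite eqxx /=; lia.
Qed.

Lemma prod_nat_shift (S : comNzRingType) (F : nat -> S) (m n : nat) :
  (m <= n)%N ->
  \prod_(m <= j < n) F j.+1 * F m = \prod_(m <= j < n) F j * F n.
Proof.
by move=> lemn; rewrite -big_nat_recr //= big_nat_recl //= mulrC.
Qed.

(** Downward induction on r, cross-multiplied to avoid division. Going from r+1 to r adds the
    columns of height exactly r+1; their factors telescope, and the end terms are the new factors at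
    i = r. *)
Lemma prod_columns_telescope (S : comNzRingType) (la : seq nat)
    (X Y : nat -> S) (t : S) (r : nat) :
  is_partition la -> (r <= size la)%N ->
  \prod_(0 <= j < nth 0%N la r) (X (conj_part la j.+1) - Y j.+1 - t)
    * \prod_(r <= i < size la) (X i.+1 - Y (nth 0%N la i.+1) - t)
  = \prod_(0 <= j < nth 0%N la r) (X (conj_part la j.+1) - Y j - t)
    * \prod_(r <= i < size la) (X i.+1 - Y (nth 0%N la i) - t).
Proof.
move=> pla; move def_d: (size la - r)%N => d.
elim: d r def_d => [|d IHd] r def_d ler.
  have -> : r = size la by lia.
  by rewrite nth_default // !big_geq.
have ltr : (r < size la)%N by lia.
have IH := IHd r.+1 ltac:(lia) ltr.
have leL := leq_part la r r.+1 pla (leqnSn r).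
have conjr j : (nth 0%N la r.+1 <= j < nth 0%N la r)%N ->
    conj_part la j.+1 = r.+1.
  by move=> /andP[lej ltj]; apply: conj_part_eq.
rewrite !(@big_cat_nat _ _ _ (nth 0%N la r.+1) 0%N (nth 0%N la r)) //=.
rewrite !(big_ltn ltr) /=.
have eqF (G : nat -> S) :
    \prod_(nth 0%N la r.+1 <= j < nth 0%N la r) (X (conj_part la j.+1) - G j - t)
    = \prod_(nth 0%N la r.+1 <= j < nth 0%N la r) (X r.+1 - G j - t).
  by apply: eq_big_nat => j Hj; rewrite conjr.
rewrite (eqF (fun j => Y j.+1)) (eqF Y).
have shift := prod_nat_shift S (fun j => X r.+1 - Y j - t) _ _ leL.
rewrite [X in _ * X = _]mulrC [X in _ = _ * X]mulrC mulrACA IH shift.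
by rewrite mulrACA.
Qed.

Lemma prod_subC_nat (S : comNzRingType) (m n : nat) (F : nat -> S) (t : S) :
  \prod_(m <= i < n) (t - F i) = (-1) ^+ (n - m) * \prod_(m <= i < n) (F i - t).
Proof.
rewrite -prodr_const_nat -big_split /=; apply: eq_bigr => i _.
by rewrite mulN1r opprB.
Qed.

(** * The identity: regular nodes first, then arbitrary variables *)

Lemma hook_identity_regular (R : comNzRingType) (la : seq nat)
    (x y : nat -> R) (hla : is_partition la) :
  (forall i j, (i < j <= size la)%N ->
     GRing.lreg ((psum x j - psum y (nth 0%N la j))
                 - (psum x i - psum y (nth 0%N la i)))) ->
  \prod_(p <- diagram la)
     (isum x p.1 (conj_part la p.2) + isum y p.2 (part la p.1))
  = \sum_(c <- outer_corners la)
      (\prod_(p <- diagram la | (p.1 != c.1) && (p.2 != c.2))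
          (isum x p.1 (conj_part la p.2) + isum y p.2 (part la p.1)))
      * (\prod_(1 <= i < c.1)
          (isum x i.+1 c.1.-1 + isum y c.2 (part la i)))
      * (\prod_(1 <= j < c.2)
          (isum x c.1 (conj_part la j) + isum y j.+1 c.2.-1)).
Proof.
move=> reg; rewrite (perm_big _ (perm_outer_corners la hla)) big_map big_filter.
(* The sum now runs over all rows 0, ..., [size la], with 0 at rows without a corner: one node more
   than there are b_i. *)
symmetry; rewrite [LHS]big_mkcond.
apply: (lead_coef_interpolation _ _ (fun r => psum x r - psum y (nth 0%N la r))
  (fun r => psum x r.+1 - psum y (nth 0%N la r))) => // r ler /=.
case: ifP => [corner|/negbT]; last first.
  rewrite negb_or -lt0n -leqNgt => /andP[r0 leL].
  rewrite mul0r (big_rem r.-1) /=; last by rewrite mem_index_iota; lia.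
  have -> : nth 0%N la r = nth 0%N la r.-1.
    by apply/eqP; rewrite eqn_leq leL leq_part // leq_pred.
  by rewrite prednK // subrr mul0r mulr0.
rewrite (prod_diagram_corner _ _ r) //=.
set t := psum x r - _.
rewrite -!mulrA; congr (_ * _).
(* Both products are split at r. Node r is dropped and later nodes shift down by one, so both tails
   range over r <= i < [size la]. *)
rewrite (@big_cat_nat _ _ _ r 0%N (size la).+1) //= 1?leqW //.
rewrite [X in _ * (_ * (_ * X))]big_ltn_cond // eqxx /=.
rewrite (@big_cat_nat _ _ _ r 0%N (size la) predT) //=.
rewrite !big_add1 /=.
(* [N] marks factors of the summand, [D] those of the full product; [row] runs over the rows above
   the corner, [col] over the columns to its left. *)
have rowN : \prod_(0 <= i < r) (isum x i.+2 r + isum y (nth 0%N la r).+1 (part la i.+1))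
  = \prod_(0 <= i < r) (t - (psum x i.+1 - psum y (nth 0%N la i))).
  apply: eq_big_nat => i /andP[_ lti].
  rewrite !isum_psum // ?leq_part // 1?ltnW // /t /part /=; ring.
have rowD : \prod_(0 <= i < r) (isum x i.+1 (conj_part la (nth 0%N la r).+1)
      + isum y (nth 0%N la r).+1 (part la i.+1))
  = \prod_(0 <= i < r | i != r) (t - (psum x i - psum y (nth 0%N la i))).
  rewrite [RHS]big_nat_cond [LHS]big_nat_cond; apply: eq_big => i; first lia.
  move=> /andP[/andP[_ lti] _].
  have -> : conj_part la (nth 0%N la r).+1 = r by apply: conj_part_eq => //; lia.
  rewrite !isum_psum // ?leq_part // 1?ltnW // /t /part /=; ring.
have colN : \prod_(0 <= j < nth 0%N la r)
      (isum x r.+1 (conj_part la j.+1) + isum y j.+2 (nth 0%N la r))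
  = \prod_(0 <= j < nth 0%N la r) (psum x (conj_part la j.+1) - psum y j.+1 - t).
  apply: eq_big_nat => j /andP[_ ltj]; have := conj_part_ge la r j.+1 hla ltj.
  move=> lt_conj; rewrite !isum_psum // 1?ltnW // /t; ring.
have colD : \prod_(0 <= j < nth 0%N la r)
      (isum x r.+1 (conj_part la j.+1) + isum y j.+1 (part la r.+1))
  = \prod_(0 <= j < nth 0%N la r) (psum x (conj_part la j.+1) - psum y j - t).
  apply: eq_big_nat => j /andP[_ ltj]; have := conj_part_ge la r j.+1 hla ltj.
  move=> lt_conj; rewrite !isum_psum // 1?ltnW // /t /part /=; ring.
rewrite rowN rowD colN colD.
have -> : \prod_(r <= i < size la | i.+1 != r)
    (t - (psum x i.+1 - psum y (nth 0%N la i.+1)))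
  = \prod_(r <= i < size la) (t - (psum x i.+1 - psum y (nth 0%N la i.+1))).
  rewrite big_nat_cond [RHS]big_nat_cond; apply: eq_bigl => i; lia.
have tele := prod_columns_telescope _ _ (psum x) (psum y) t _ hla ler.
(* The telescoping uses F i - t instead of t - F i; both sides acquire the same powers of -1. *)
rewrite !prod_subC_nat.
set A := \prod_(0 <= i < r) _; set B := \prod_(0 <= i < r | _) _.
move: tele; set C := \prod_(0 <= j < _) _; set D := \prod_(r <= i < _) _.
set C' := \prod_(0 <= j < _) _; set D' := \prod_(r <= i < _) _ => tele.
transitivity ((-1) ^+ (r - 0) * A * B * (-1) ^+ (size la - r) * (C * D)).
  by ring.
by rewrite tele; ring.
Qed.

(* The deformation telescopes in [psum], so that differences of nodes become
   monic; it vanishes at 'X = 0 even for k = 0. *)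
Lemma lreg_psum_lift (R : comNzRingType) (x : nat -> R) (c : R) (i j : nat) :
  let x' k := (x k)%:P + ('X^(k.+2) - 'X^(k.+1)) in
  (i < j)%N -> GRing.lreg (psum x' j - psum x' i - c%:P).
Proof.
move=> x' ltij.
have psum_x' n : psum x' n = (psum x n)%:P + ('X^(n.+2) - 'X^2).
  rewrite /psum big_split /=; congr (_ + _); first by rewrite rmorph_sum.
  by rewrite (telescope_sumr (fun k => 'X^(k.+1))).
have -> : psum x' j - psum x' i - c%:P
  = 'X^(j.+2) + ((psum x j - psum x i - c)%:P - 'X^(i.+2)).
  by rewrite !psum_x' !rmorphB /=; ring.
apply: monic_lreg; rewrite monicE lead_coefDl ?lead_coefXn //.
rewrite size_polyXn (leq_ltn_trans (size_polyD _ _)) // size_polyN size_polyXn.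
by rewrite gtn_max !ltnS ltij (leq_trans (size_polyC_leq1 _)).
Qed.

Lemma horner_isum (R : comNzRingType) (z : nat -> {poly R}) (t : R) (a b : nat) :
  (isum z a b).[t] = isum (fun k => (z k).[t]) a b.
Proof. by rewrite /isum horner_sum. Qed.

Theorem theorem1 (R : comNzRingType) (la : seq nat) (x y : nat -> R)
    (hla : is_partition la) :
  \prod_(p <- diagram la)
     (isum x p.1 (conj_part la p.2) + isum y p.2 (part la p.1))
  = \sum_(c <- outer_corners la)
      (\prod_(p <- diagram la | (p.1 != c.1) && (p.2 != c.2))
          (isum x p.1 (conj_part la p.2) + isum y p.2 (part la p.1)))
      * (\prod_(1 <= i < c.1)
          (isum x i.+1 c.1.-1 + isum y c.2 (part la i)))
      * (\prod_(1 <= j < c.2)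
          (isum x c.1 (conj_part la j) + isum y j.+1 c.2.-1)).
Proof.
pose x' k := (x k)%:P + ('X^(k.+2) - 'X^(k.+1)).
pose y' k := (y k)%:P.
have psum_y' n : psum y' n = (psum y n)%:P by rewrite /psum rmorph_sum.
have x'0 a b : (isum x' a b).[0] = isum x a b.
  rewrite horner_isum; apply: eq_bigr => k _.
  by rewrite /x' hornerD hornerC hornerD hornerN !hornerXn !expr0n /= subrr addr0.
have y'0 a b : (isum y' a b).[0] = isum y a b.
  by rewrite horner_isum; apply: eq_bigr => k _; rewrite hornerC.
(* The regular case is applied over [{poly R}]; evaluation at 0 then recovers x and y. *)
have := hook_identity_regular _ _ x' y' hla.
move=> /(_ _)/(congr1 (fun p => p.[0])) /=; rewrite horner_sum horner_prod.
under eq_bigr do rewrite hornerD x'0 y'0.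
move=> ->.
- apply: eq_bigr => c _; rewrite !hornerM !horner_prod.
  by congr (_ * _ * _); apply: eq_bigr => k _; rewrite hornerD x'0 y'0.
- move=> i j /andP[ltij _]; rewrite !psum_y'.
  (* As y is not deformed, its contribution to a node difference is a constant polynomial. *)
  rewrite (_ : _ - _ = psum x' j - psum x' i
     - (psum y (nth 0%N la j) - psum y (nth 0%N la i))%:P).
    exact: lreg_psum_lift.
  by rewrite rmorphB /=; ring.
Qed.
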